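(* Let $R$ be a ring (with identity, not necessarily commutative) and let $X$ be a locally finite partially ordered set. If $\mathrm{Soc}_l(R)=\mathrm{Soc}_r(R)$ and $X$ is an antichain, then $\mathrm{Soc}_l(I(X,R))=\mathrm{Soc}_r(I(X,R))$. Moreover, in this case, the left/right socle of $I(X,R)$ is $$\mathrm{Soc}(I(X,R))=\bigoplus_{x\in X}\mathrm{Soc}(R),$$ where $\mathrm{Soc}(R):=\mathrm{Soc}_l(R)=\mathrm{Soc}_r(R)$.
   Context: A partially ordered set $X$ is locally finite if every interval $[x,y]=\{z\in X: x\le z\le y\}$ is finite; $X$ is an antichain if any two distinct elements are incomparable. The incidence ring $I(X,R)$ is the set of functions $f:X\times X\to R$ with $f(x,y)=0$ unless $x\le y$, with pointwise addition and product $(fg)(x,y)=\sum_{x\le z\le y} f(x,z)g(z,y)$. For a ring $A$, the left (right) socle $\mathrm{Soc}_l(A)$ ($\mathrm{Soc}_r(A)$) is the sum of all minimal left (right) ideals of $A$; when they agree, the common ideal is written $\mathrm{Soc}(A)$. When $X$ is an antichain, elements of $I(X,R)$ are supported on the diagonal, and the copy of $\mathrm{Soc}(R)$ indexed by $x$ in the direct sum is identified with $\{f\in I(X,R): f(x,x)\in\mathrm{Soc}(R),\ f(u,v)=0 \text{ for } (u,v)\neq(x,x)\}$. *)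

(* Defs.v *)
From HB Require Import structures.
From mathcomp Require Export all_boot all_order all_algebra.
From mathcomp Require Export boolp classical_sets functions cardinality fsbigop.

Set Implicit Arguments.
Unset Strict Implicit.
Unset Printing Implicit Defensive.

Import Order.TTheory GRing.Theory.

Local Open Scope classical_set_scope.
Local Open Scope ring_scope.

HB.mixin Record POrder_isLocallyFinite d T of Order.POrder d T := {
  finite_interval : forall x y : T, finite_set [set z : T | (x <= z <= y)%O]
}.

#[short(type="lfPOrderType")]
HB.structure Definition LocallyFinitePOrder d :=
  { T of Order.POrder d T & POrder_isLocallyFinite d T }.

Definition antichain d (X : porderType d) : Prop :=
  forall x y : X, x != y -> (x >< y)%O.

Record incidence d (X : lfPOrderType d) (R : pzRingType) := Incidence {
  incidence_fun :> X -> X -> R;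
  incidence_supp : forall x y : X, ~~ (x <= y)%O -> incidence_fun x y = 0
}.

HB.instance Definition _ d (X : lfPOrderType d) (R : pzRingType) :=
  gen_eqMixin (incidence X R).
HB.instance Definition _ d (X : lfPOrderType d) (R : pzRingType) :=
  gen_choiceMixin (incidence X R).

Section IncidenceRing.
Context d (X : lfPOrderType d) (R : pzRingType).
Implicit Types (f g h : incidence X R) (x y z : X).

Lemma incidenceP f g : (forall x y, f x y = g x y) -> f = g.
Proof.
case: f g => [f fP] [g gP] /= fg.
have {fg} E : f = g by apply/funext => x; apply/funext => y.
by subst g; congr Incidence; apply: Prop_irrelevance.
Qed.

Fact incidence0_supp x y : ~~ (x <= y)%O -> (0 : R) = 0.
Proof. by []. Qed.
Definition incidence0 : incidence X R :=
  Incidence (incidence_fun := fun _ _ => 0) incidence0_supp.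

Fact incidenceN_supp f x y : ~~ (x <= y)%O -> - f x y = 0.
Proof. by move=> xy; rewrite incidence_supp ?oppr0. Qed.
Definition incidenceN f : incidence X R :=
  Incidence (incidence_fun := fun x y => - f x y) (@incidenceN_supp f).

Fact incidenceD_supp f g x y : ~~ (x <= y)%O -> f x y + g x y = 0.
Proof. by move=> xy; rewrite !incidence_supp ?addr0. Qed.
Definition incidenceD f g : incidence X R :=
  Incidence (incidence_fun := fun x y => f x y + g x y) (@incidenceD_supp f g).

Fact incidence1_supp x y : ~~ (x <= y)%O -> (x == y)%:R = 0 :> R.
Proof. by case: eqP => // ->; rewrite lexx. Qed.
Definition incidence1 : incidence X R :=
  Incidence (incidence_fun := fun x y => (x == y)%:R) incidence1_supp.

Fact incidenceM_supp f g x y : ~~ (x <= y)%O ->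
  \sum_(z \in [set z | (x <= z <= y)%O]) f x z * g z y = 0.
Proof.
move=> xy; apply: fsbig1 => z /= /andP[xz zy].
by rewrite (le_trans xz zy) in xy.
Qed.
Definition incidenceM f g : incidence X R :=
  Incidence (incidence_fun := fun x y =>
    \sum_(z \in [set z | (x <= z <= y)%O]) f x z * g z y)
    (@incidenceM_supp f g).

Fact incidenceDA : associative incidenceD.
Proof. by move=> f g h; apply: incidenceP => x y /=; rewrite addrA. Qed.
Fact incidenceDC : commutative incidenceD.
Proof. by move=> f g; apply: incidenceP => x y /=; rewrite addrC. Qed.
Fact incidence0D : left_id incidence0 incidenceD.
Proof. by move=> f; apply: incidenceP => x y /=; rewrite add0r. Qed.
Fact incidenceND : left_inverse incidence0 incidenceN incidenceD.
Proof. by move=> f; apply: incidenceP => x y /=; rewrite addNr. Qed.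

HB.instance Definition _ := GRing.isZmodule.Build (incidence X R)
  incidenceDA incidenceDC incidence0D incidenceND.

Lemma incidence_mulE f g x y (s : seq X) : uniq s ->
  (forall z, (x <= z <= y)%O -> z \in s) ->
  incidenceM f g x y = \sum_(z <- s) f x z * g z y.
Proof.
move=> us sP /=; rewrite [RHS]fsbig_seq //.
apply: fsbig_widen => z /=; first exact: sP.
move=> [_ /negP]; rewrite negb_and => /orP[] nz.
  by rewrite incidence_supp ?mul0r.
by rewrite [g z y]incidence_supp ?mulr0.
Qed.

Lemma interval_seq x y : exists2 s : seq X, uniq s &
  forall z, (x <= z <= y)%O -> z \in s.
Proof.
have /finite_seqP[s sE] := @finite_interval _ X x y.
exists (undup s); first exact: undup_uniq.
move=> z xzy; rewrite mem_undup.
have : [set z | (x <= z <= y)%O] z by [].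
by rewrite sE.
Qed.

Fact incidenceMA : associative incidenceM.
Proof.
move=> f g h; apply: incidenceP => x y.
have [s us sP] := interval_seq x y.
rewrite !(incidence_mulE _ _ us sP).
transitivity (\sum_(z <- s) \sum_(w <- s) f x z * g z w * h w y).
  apply: eq_bigr => z _; have [xz|xz] := boolP (x <= z)%O; last first.
    by rewrite incidence_supp // mul0r big1 // => w _; rewrite !mul0r.
  rewrite (@incidence_mulE _ _ _ _ s) //; last first.
    by move=> w /andP[zw wy]; rewrite sP // wy (le_trans xz zw).
  by rewrite mulr_sumr; apply: eq_bigr => w _; rewrite mulrA.
rewrite exchange_big; apply: eq_bigr => w _.
have [wy|wy] := boolP (w <= y)%O; last first.
  by rewrite [h w y]incidence_supp // mulr0 big1 // => z _; rewrite mulr0.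
rewrite (@incidence_mulE _ _ _ _ s) ?mulr_suml //.
by move=> z /andP[xz zw]; rewrite sP // xz (le_trans zw wy).
Qed.

Fact incidence1M : left_id incidence1 incidenceM.
Proof.
move=> f; apply: incidenceP => x y.
have [xy|xy] := boolP (x <= y)%O; last by rewrite !incidence_supp.
have [s us sP] := interval_seq x y.
rewrite (incidence_mulE _ _ us sP) (bigD1_seq x) //=; last first.
  by rewrite sP // lexx.
rewrite eqxx mul1r big1 ?addr0 // => z /negPf zx.
by rewrite eq_sym zx mul0r.
Qed.

Fact incidenceM1 : right_id incidence1 incidenceM.
Proof.
move=> f; apply: incidenceP => x y.
have [xy|xy] := boolP (x <= y)%O; last by rewrite !incidence_supp.
have [s us sP] := interval_seq x y.
rewrite (incidence_mulE _ _ us sP) (bigD1_seq y) //=; last first.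
  by rewrite sP // lexx andbT.
rewrite eqxx mulr1 big1 ?addr0 // => z /negPf zy.
by rewrite zy mulr0.
Qed.

Fact incidenceMDl : left_distributive incidenceM +%R.
Proof.
move=> f g h; apply: incidenceP => x y.
have [s us sP] := interval_seq x y.
rewrite -[RHS]/(incidenceM f h x y + incidenceM g h x y).
rewrite !(incidence_mulE _ _ us sP) -big_split /=.
by apply: eq_bigr => z _; rewrite mulrDl.
Qed.

Fact incidenceMDr : right_distributive incidenceM +%R.
Proof.
move=> f g h; apply: incidenceP => x y.
have [s us sP] := interval_seq x y.
rewrite -[RHS]/(incidenceM f g x y + incidenceM f h x y).
rewrite !(incidence_mulE _ _ us sP) -big_split /=.
by apply: eq_bigr => z _; rewrite mulrDr.
Qed.

HB.instance Definition _ := GRing.Zmodule_isPzRing.Build (incidence X R)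
  incidenceMA incidence1M incidenceM1 incidenceMDl incidenceMDr.

End IncidenceRing.

(* The ideals of ring_quotient are required to be proper; minimal ideals need
   not be (e.g. in a division ring), hence the following predicates. *)
Definition additive_subgroup (M : zmodType) (N : set M) : Prop :=
  N 0 /\ forall u v, N u -> N v -> N (u - v).

Definition left_ideal (A : pzRingType) (I : set A) : Prop :=
  additive_subgroup I /\ forall a u, I u -> I (a * u).

Definition right_ideal (A : pzRingType) (I : set A) : Prop :=
  additive_subgroup I /\ forall a u, I u -> I (u * a).

Definition minimal_left_ideal (A : pzRingType) (I : set A) : Prop :=
  [/\ left_ideal I, I <> [set 0] &
      forall J : set A, left_ideal J -> J `<=` I -> J = [set 0] \/ J = I].

Definition minimal_right_ideal (A : pzRingType) (I : set A) : Prop :=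
  [/\ right_ideal I, I <> [set 0] &
      forall J : set A, right_ideal J -> J `<=` I -> J = [set 0] \/ J = I].

(* The sum of the subsets [N i], [i] ranging over the possibly infinite set
   [D]: all finite sums of elements of these subsets. *)
Definition sum_of (T : Type) (M : zmodType) (D : set T) (N : T -> set M) :
    set M :=
  [set m | exists (n : nat) (i : 'I_n -> T) (u : 'I_n -> M),
     (forall k, D (i k) /\ N (i k) (u k)) /\ m = \sum_(k < n) u k].

Definition left_socle (A : pzRingType) : set A :=
  sum_of [set I | minimal_left_ideal I] (fun I => I).
Arguments left_socle A : clear implicits.

Definition right_socle (A : pzRingType) : set A :=
  sum_of [set I | minimal_right_ideal I] (fun I => I).
Arguments right_socle A : clear implicits.

(* Internal direct sum: [S] is the sum of the additive subgroups [N i], each of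
   which meets the sum of the others trivially. *)
Definition is_direct_sum (T : Type) (M : zmodType) (N : T -> set M)
    (S : set M) : Prop :=
  [/\ forall i, additive_subgroup (N i),
      S = sum_of setT N &
      forall i, N i `&` sum_of [set j | j <> i] N = [set 0]].

(* The copy of [S] placed at the diagonal entry [(x, x)]. *)
Definition diag_copy d (X : lfPOrderType d) (R : pzRingType) (S : set R)
    (x : X) : set (incidence X R) :=
  [set f | S (f x x) /\ forall u v : X, (u, v) <> (x, x) -> f u v = 0].
Arguments diag_copy {d} X {R} S x.

(* Main.v *)
(** When [X] is an antichain, [I(X, R)] is the product ring [R^X]. A nonzero
    one-sided ideal of this product contains a nonzero element supported at a
    single point [x] (multiply by the central idempotent at [x]), so a minimal
    one is a minimal one-sided ideal of [R] placed at some [(x, x)]; conversely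
    every such copy is minimal. Hence the socle on either side is the direct sum
    of the copies of the socle of [R] on that side. *)

Require Import Defs.

Set Implicit Arguments.
Unset Strict Implicit.
Unset Printing Implicit Defensive.

Import Order.TTheory GRing.Theory.

Local Open Scope classical_set_scope.
Local Open Scope ring_scope.

(** * Sums of additive subgroups, and ideals and socles parametrized by their side *)

Lemma additive_subgroupD (M : zmodType) (N : set M) u v :
  additive_subgroup N -> N u -> N v -> N (u + v).
Proof.
case=> N0 NB Nu Nv; rewrite -[v]opprK -[- v]sub0r.
exact: NB Nu (NB _ _ N0 Nv).
Qed.

Lemma sum_of_subgroup (T : Type) (M : zmodType) (D : set T) (N : T -> set M) :
  (forall i, D i -> additive_subgroup (N i)) -> additive_subgroup (sum_of D N).
Proof.
move=> Nsub; split.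
  (* The empty sum represents zero. [T] may be empty, so the indexing map is obtained from the
     absurdity of an element of ['I_0]. *)
  by exists 0, (fun k : 'I_0 => False_rect T (notF (ltn_ord k))), (fun=> 0);
     split=> [[]//|]; rewrite big_ord0.
move=> _ _ [m [i [u [iP ->]]]] [n [j [v [jP ->]]]].
exists (m + n)%N,
  (fun k : 'I_(m + n) =>
     match fintype.split k with inl a => i a | inr b => j b end),
  (fun k : 'I_(m + n) =>
     match fintype.split k with inl a => u a | inr b => - v b end).
split.
  move=> k; case: (fintype.split k) => [a|b]; first exact: iP.
  have [Dj Nv] := jP b; split=> //; have [N0 NB] := Nsub _ Dj.
  by rewrite -sub0r; apply: NB.
rewrite big_split_ord -sumrN; congr (_ + _); apply: eq_bigr => k _.
  by have := unsplitK (inl _ k : 'I_m + 'I_n) => /= ->.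
by have := unsplitK (inr _ k : 'I_m + 'I_n) => /= ->.
Qed.

Lemma sub_sum_of (T : Type) (M : zmodType) (D : set T) (N : T -> set M) i :
  D i -> N i `<=` sum_of D N.
Proof.
move=> Di u Nu; exists 1%N, (fun=> i), (fun=> u); split=> //.
by rewrite big_ord1.
Qed.

Lemma sum_of_sub (T : Type) (M : zmodType) (D : set T) (N : T -> set M) S :
  additive_subgroup S -> (forall i, D i -> N i `<=` S) -> sum_of D N `<=` S.
Proof.
move=> Ssub NS _ [n [i [u [iP ->]]]]; elim/big_ind: _ => [|a b|k _].
- by case: Ssub.
- exact: additive_subgroupD.
- by have [Di Nu] := iP k; apply: NS Nu.
Qed.

(* At [left = true] and [left = false] these are convertible to the left and
   right notions of the statement, so both sides are treated at once. *)
Definition sided_ideal (left : bool) (A : pzRingType) (I : set A) : Prop :=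
  additive_subgroup I /\
  forall a u, I u -> I (if left then a * u else u * a).

Definition minimal_sided_ideal (left : bool) (A : pzRingType) (I : set A) :
    Prop :=
  [/\ sided_ideal left I, I <> [set 0] &
      forall J : set A, sided_ideal left J -> J `<=` I ->
        J = [set 0] \/ J = I].

Definition sided_socle (left : bool) (A : pzRingType) : set A :=
  sum_of [set I | minimal_sided_ideal left I] (fun I => I).
Arguments sided_socle left A : clear implicits.

Lemma sided_socle_subgroup left (A : pzRingType) :
  additive_subgroup (sided_socle left A).
Proof. by apply: sum_of_subgroup => I [[]]. Qed.

(** * Functions supported at one diagonal entry *)

Section Diagonal.
Context d (X : lfPOrderType d) (R : pzRingType).
Implicit Types (f g : incidence X R) (x : X) (r : R) (S : set R).

Fact diag_unit_supp x r (u v : X) :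
  ~~ (u <= v)%O -> (if (u == x) && (v == x) then r else 0) = 0.
Proof. by case: andP => // -[/eqP-> /eqP->]; rewrite lexx. Qed.
Definition diag_unit x r : incidence X R :=
  Incidence (incidence_fun := fun u v => if (u == x) && (v == x) then r else 0)
    (@diag_unit_supp x r).

Lemma diag_unitxx x r : diag_unit x r x x = r.
Proof. by rewrite /= eqxx. Qed.

Lemma diag_unit0 x : diag_unit x 0 = 0.
Proof. by apply: incidenceP => u v /=; case: ifP. Qed.

Lemma diag_unitB x r r' : diag_unit x (r - r') = diag_unit x r - diag_unit x r'.
Proof. by apply: incidenceP => u v /=; case: ifP => //; rewrite subr0. Qed.

Lemma diag_copy_unit S x r : S r -> diag_copy X S x (diag_unit x r).
Proof.
move=> Sr; split=> [|u v uv]; first by rewrite diag_unitxx.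
by rewrite /=; case: andP => // -[/eqP ux /eqP vx]; case: uv; rewrite ux vx.
Qed.

Lemma diag_copyE S x f : diag_copy X S x f -> f = diag_unit x (f x x).
Proof.
move=> [_ f0]; apply: incidenceP => u v /=.
case: andP => [[/eqP-> /eqP->]//|uv].
by apply: f0 => -[ux vx]; apply: uv; rewrite ux vx !eqxx.
Qed.

Lemma diag_copy_subgroup S x :
  additive_subgroup S -> additive_subgroup (diag_copy X S x).
Proof.
move=> [S0 SB]; split=> [|f g [Sf f0] [Sg g0]]; first by split.
split=> [|u v uv]; first exact: SB.
by rewrite -[LHS]/(f u v - g u v) f0 // g0 // subrr.
Qed.

Lemma incidence_mul_diag f g x : (f * g) x x = f x x * g x x.
Proof.
rewrite -[LHS]/(incidenceM f g x x) (incidence_mulE _ _ (s := [:: x])) //.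
  by rewrite big_seq1.
by move=> z xzx; rewrite inE eq_sym eq_le.
Qed.

(** Evaluation at [(x, x)] separates the copies: it kills every copy at [y <> x], hence their sum,
    whereas an element of the copy at [x] is determined by its value there. No antichain assumption
    enters. *)
Lemma diag_copies_independent S x : additive_subgroup S ->
  diag_copy X S x `&` sum_of [set y | y <> x] (diag_copy X S) = [set 0].
Proof.
move=> Ssub; apply/seteqP; split=> [f [fx fsum]|_ ->].
  have vanish : sum_of [set y | y <> x] (diag_copy X S) `<=`
      [set g | g x x = 0].
    apply: sum_of_sub.
      split=> // g h /= gx hx.
      by rewrite -[LHS]/(g x x - h x x) gx hx subrr.
    by move=> y /= yx g [_ g0] /=; apply: g0 => -[xy _]; apply: yx.
  by rewrite /= (diag_copyE fx) (vanish _ fsum) diag_unit0.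
split; first by case: (diag_copy_subgroup x Ssub).
suff [] : additive_subgroup (sum_of [set y | y <> x] (diag_copy X S)) by [].
by apply: sum_of_subgroup => y _; apply: diag_copy_subgroup.
Qed.

(** * Entrywise arithmetic over an antichain *)

Hypothesis hX : antichain X.

Lemma incidence_offdiag f (u v : X) : u != v -> f u v = 0.
Proof.
move=> uv; apply: incidence_supp; apply: contraTN (hX uv) => le_uv.
by rewrite negbK /Order.comparable le_uv.
Qed.

Lemma incidence_diagP f g : (forall x, f x x = g x x) -> f = g.
Proof.
move=> fg; apply: incidenceP => u v.
by have [->|uv] := eqVneq u v; rewrite ?fg // !incidence_offdiag.
Qed.

Lemma sided_mul_diag (left : bool) f g x :
  (if left then f * g else g * f) x x =
  (if left then f x x * g x x else g x x * f x x).
Proof. by case: left; rewrite incidence_mul_diag. Qed.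

(** A multiplier [f] acts on an element supported at [x] only through the scalar [f x x]; thus ideal
    structure at [x] is the same in [R] and in the incidence ring. *)
Lemma sided_mul_unit (left : bool) f x r :
  (if left then f * diag_unit x r else diag_unit x r * f) =
  diag_unit x (if left then f x x * r else r * f x x).
Proof.
apply: incidence_diagP => y; rewrite sided_mul_diag /= andbb.
by case: eqP => [->//|_]; case: left; rewrite ?mulr0 ?mul0r.
Qed.

(** * Transfer of one-sided ideals between [R] and the incidence ring *)

Lemma diag_copy_ideal left S x :
  sided_ideal left S -> sided_ideal left (diag_copy X S x).
Proof.
move=> [Ssub SM]; split=> [|a f fx]; first exact: diag_copy_subgroup.
by rewrite (diag_copyE fx) sided_mul_unit; apply/diag_copy_unit/SM; case: fx.
Qed.

Lemma diag_fiber_ideal left (J : set (incidence X R)) x :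
  sided_ideal left J -> sided_ideal left [set r | J (diag_unit x r)].
Proof.
move=> [[J0 JB] JM]; split; first split => [|u v Ju Jv] /=.
- by rewrite diag_unit0.
- by rewrite diag_unitB; apply: JB.
- by move=> a u /= Ju; have := JM (diag_unit x a) _ Ju;
     rewrite sided_mul_unit diag_unitxx.
Qed.

(** An ideal [J] inside the copy of [S] is recovered from its fiber at [x], an ideal of [R]
    contained in [S]; minimality of [S] leaves only the fibers zero and [S]. *)
Lemma diag_copy_minimal left S x :
  minimal_sided_ideal left S -> minimal_sided_ideal left (diag_copy X S x).
Proof.
move=> [Sid Sn0 Smin]; split; first exact: diag_copy_ideal.
  move=> S0; apply: Sn0; apply/seteqP; split=> [r Sr|_ ->]; last first.
    by case: Sid => -[].
  have : [set 0] (diag_unit x r) by rewrite -S0; apply: diag_copy_unit.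
  by move=> /= r0; rewrite -(diag_unitxx x r) r0.
move=> J Jid JS; have [|KE|KE] := Smin _ (diag_fiber_ideal x Jid).
- by move=> r /= /JS[]; rewrite diag_unitxx.
- left; apply/seteqP; split=> [f Jf|_ ->]; last by case: Jid => -[].
  have : [set r | J (diag_unit x r)] (f x x).
    by rewrite /= -(diag_copyE (JS _ Jf)).
  by rewrite KE /= => fx0; rewrite (diag_copyE (JS _ Jf)) fx0 diag_unit0.
- right; apply/seteqP; split=> // f fS; rewrite (diag_copyE fS).
  by have : S (f x x) by [case: fS]; rewrite -KE.
Qed.

Lemma minimal_supported left (M : set (incidence X R)) :
  minimal_sided_ideal left M -> exists x, M `<=` diag_copy X setT x.
Proof.
move=> [Mid Mn0 Mmin].
have [f Mf [x fx]] : exists2 f, M f & exists x, f x x <> 0.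
  apply: contrapT => noM; apply: Mn0; apply/seteqP.
  split=> [f Mf|_ ->]; last by case: Mid => -[].
  apply: incidence_diagP => x; apply: contrapT => fx.
  by apply: noM; exists f => //; exists x.
exists x; have Tid : sided_ideal left (@setT R) by [].
have [[[T0 TB] TM] [[M0 MB] MM]] := (diag_copy_ideal x Tid, Mid).
(* By minimality this intersection is zero or [M], and the second case is the claim. The first is
   refuted by cutting [f] down to its nonzero entry at [x]. *)
have Jid : sided_ideal left (M `&` diag_copy X setT x).
  split; first split=> // u v [Mu Tu] [Mv Tv].
    by split; [apply: MB|apply: TB].
  by move=> a u [Mu Tu]; split; [apply: MM|apply: TM].
have [//|J0|<- //] := Mmin _ Jid; case: fx.
suff : [set 0] (diag_unit x (f x x)).
  by move=> /= fx0; rewrite -(diag_unitxx x (f x x)) fx0.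
rewrite -J0; split; last exact: diag_copy_unit.
(* The idempotent [diag_unit x 1] multiplies [f] on the side on which [M] absorbs products, so the
   truncation of [f] stays in [M]. *)
suff <- : (if left then diag_unit x 1 * f else f * diag_unit x 1) =
  diag_unit x (f x x) by apply: MM.
apply: incidence_diagP => y; rewrite sided_mul_diag /= andbb.
by case: eqP => [->|_]; case: left {Mid Mmin Tid TM MM Jid};
  rewrite ?(mul1r, mulr1, mul0r, mulr0).
Qed.

(** Since [M] is supported at one [x], it is the copy of its own fiber there. An ideal of [R] below
    the fiber has its copy below [M], so the fiber inherits minimality. *)
Lemma minimal_diag left (M : set (incidence X R)) :
  minimal_sided_ideal left M ->
  exists x, exists2 S, minimal_sided_ideal left S & M = diag_copy X S x.
Proof.
move=> Mmin; have [x Mx] := minimal_supported Mmin; exists x.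
have ME : M = diag_copy X [set r | M (diag_unit x r)] x.
  apply/seteqP; split=> f; last by move=> fx; rewrite (diag_copyE fx); case: fx.
  by move=> Mf; rewrite (diag_copyE (Mx _ Mf)); apply: diag_copy_unit;
     rewrite /= -(diag_copyE (Mx _ Mf)).
exists [set r | M (diag_unit x r)] => //.
have [Mid Mn0 Mleast] := Mmin; split; first exact: diag_fiber_ideal.
  move=> S0; apply: Mn0; apply/seteqP; split=> [f|_ ->]; last first.
    by case: Mid => -[].
  by rewrite ME S0 => f0 /=; rewrite (diag_copyE f0); case: f0 => /= -> _;
     rewrite diag_unit0.
move=> K Kid KS; have [|K0|KE] := Mleast _ (diag_copy_ideal x Kid).
- by rewrite ME => f [/KS Kf f0]; split.
- left; apply/seteqP; split=> [r Kr|_ ->]; last by case: Kid => -[].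
  have : [set 0] (diag_unit x r) by rewrite -K0; apply: diag_copy_unit.
  by move=> /= r0; rewrite -(diag_unitxx x r) r0.
- right; apply/seteqP; split=> // r /=; rewrite -KE => -[].
  by rewrite diag_unitxx.
Qed.

Lemma sided_socle_antichain left :
  sided_socle left (incidence X R) =
  sum_of setT (diag_copy X (sided_socle left R)).
Proof.
apply/seteqP; split; apply: sum_of_sub.
- apply: sum_of_subgroup => x _.
  exact/diag_copy_subgroup/sided_socle_subgroup.
- move=> M /minimal_diag[x [S Smin ->]] f [Sf f0].
  apply: (@sub_sum_of _ _ _ _ x) => //; split=> //.
  exact: (@sub_sum_of _ _ [set I | minimal_sided_ideal left I] id S).
- exact: sided_socle_subgroup.
- move=> x _ f fx; rewrite (diag_copyE fx); case: fx => + _.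
  have [Z0 ZB] := sided_socle_subgroup left (incidence X R).
  (* The scalars whose copy at [x] lies in the big socle form an additive subgroup containing every
     minimal ideal of [R], hence the socle of [R]. *)
  have sub : sided_socle left R `<=`
      [set r | sided_socle left (incidence X R) (diag_unit x r)].
    apply: sum_of_sub => [|S Smin r Sr] /=.
      by split=> [|u v] /=; [rewrite diag_unit0|rewrite diag_unitB; apply: ZB].
    apply: (@sub_sum_of _ _ [set I | minimal_sided_ideal left I] id
      (diag_copy X S x)); first exact: diag_copy_minimal.
    exact: diag_copy_unit.
  exact: sub.
Qed.

End Diagonal.

Theorem proposition3p0p16 (d : Order.disp_t) (X : lfPOrderType d)
    (R : pzRingType) (hR : left_socle R = right_socle R)
    (hX : antichain X) :
  left_socle (incidence X R) = right_socle (incidence X R) /\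
  is_direct_sum (diag_copy X (left_socle R)) (left_socle (incidence X R)).
Proof.
(* The left and right decompositions differ only in which socle of [R] they use, and [hR] identifies
   these. *)
have lE := sided_socle_antichain R hX true.
have rE := sided_socle_antichain R hX false.
have lsub := sided_socle_subgroup true R.
split.
  rewrite -[LHS]/(sided_socle true _) -[RHS]/(sided_socle false _) lE rE.
  by rewrite -[sided_socle true R]/(left_socle R) hR.
split=> // x; first exact: diag_copy_subgroup.
exact: diag_copies_independent.
Qed.
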